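(* Let $\mathsf{X}$ be a one-sided shift space over a finite alphabet $\mathcal{A}$. Let $\{p_A,\ s_a : A\in\mathcal{B}_{\mathsf{X}},\ a\in\mathcal{A}\}$ and $\{S_a : a\in\mathcal{A}\}$ be the canonical generators of $C^*(E_{\mathsf{X}},\mathcal{L}_{\mathsf{X}},\mathcal{B}_{\mathsf{X}})$ and $C^*(\mathsf{X})$, respectively. Then the map $S_a\mapsto s_a$ for $a\in\mathcal{A}$ induces an isomorphism from $C^*(\mathsf{X})$ to $C^*(E_{\mathsf{X}},\mathcal{L}_{\mathsf{X}},\mathcal{B}_{\mathsf{X}})$.
   Context: A one-sided shift space over a finite alphabet $\mathcal{A}$ is a closed subset $\mathsf{X}\subseteq\mathcal{A}^{\mathbb{N}}$ with $\sigma(\mathsf{X})\subseteq\mathsf{X}$, $\sigma$ the shift; every letter of $\mathcal{A}$ is assumed to occur in $\mathsf{X}$. The labelled space of $\mathsf{X}$. $E_{\mathsf{X}}$ is the directed graph with vertex set $E_{\mathsf{X}}^0=\mathsf{X}$, edge set $E^1_{\mathsf{X}}=\{(x,a,y)\in\mathsf{X}\times\mathcal{A}\times\mathsf{X}:x=ay\}$, source $s(x,a,y)=x$, range $r(x,a,y)=y$, and labelling $\mathcal{L}_{\mathsf{X}}(x,a,y)=a$. $\mathcal{L}_{\mathsf{X}}^*(E_{\mathsf{X}})$ is the set of labels $\mathcal{L}_{\mathsf{X}}(e_1)\cdots\mathcal{L}_{\mathsf{X}}(e_n)$ of finite paths $e_1\cdots e_n$, $n\ge1$ (paths satisfy $r(e_i)=s(e_{i+1})$),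 and $\mathcal{L}^\#_{\mathsf{X}}(E_{\mathsf{X}})=\mathcal{L}_{\mathsf{X}}^*(E_{\mathsf{X}})\cup\{\epsilon\}$ with $\epsilon$ the empty word. For $u,v\in\mathcal{L}^\#_{\mathsf{X}}(E_{\mathsf{X}})$, $C(u,v)=\{vx\in\mathsf{X}:ux\in\mathsf{X}\}$. $\mathcal{B}_{\mathsf{X}}$ is the smallest subset of $2^{\mathsf{X}}$ closed under finite intersections, finite unions and relative complements and containing all $C(u,v)$, $u,v\in\mathcal{L}^\#_{\mathsf{X}}(E_{\mathsf{X}})$. The $C^*$-algebra of the labelled space. For $A\subseteq\mathsf{X}$, $a\in\mathcal{A}$: $r(A,a)=\{r(e):e\in E_{\mathsf{X}}^1,\ \mathcal{L}_{\mathsf{X}}(e)=a,\ s(e)\in A\}$, $r(a)=r(\mathsf{X},a)$, $\mathcal{L}_{\mathsf{X}}(AE_{\mathsf{X}}^1)=\{\mathcal{L}_{\mathsf{X}}(e):s(e)\in A\}$. The graph $E_{\mathsf{X}}$ has no sinks. $C^*(E_{\mathsf{X}},\mathcal{L}_{\mathsf{X}},\mathcal{B}_{\mathsf{X}})$ is the universal $C^*$-algebra generated by projections $\{p_A:A\in\mathcal{B}_{\mathsf{X}}\}$ and partial isometries $\{s_a:a\in\mathcal{A}\}$ such that: (i) $p_Ap_B=p_{A\cap B}$, $p_{A\cup B}=p_A+p_B-p_{A\cap B}$, $p_\emptyset=0$; (ii) $p_As_a=s_ap_{r(A,a)}$; (iii) $s_a^*s_a=p_{r(a)}$ and $s_a^*s_b=0$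 unless $a=b$; (iv) for $A\in\mathcal{B}_{\mathsf{X}}$ with $\mathcal{L}_{\mathsf{X}}(AE^1_{\mathsf{X}})$ finite and $A\cap B=\emptyset$ for every $B\in\mathcal{B}_{\mathsf{X}}$ consisting of sinks (the latter condition being vacuous here), $p_A=\sum_{a\in\mathcal{L}_{\mathsf{X}}(AE^1_{\mathsf{X}})}s_ap_{r(A,a)}s_a^*$. The algebra $C^*(\mathsf{X})$. Let $\chi_A$ denote the characteristic function of $A\subseteq\mathsf{X}$ and let $\widetilde{\mathcal{D}}_{\mathsf{X}}$ be the $C^*$-algebra (of bounded functions on $\mathsf{X}$) generated by $\{\chi_{C(u,v)}:u,v\in\mathcal{L}^\#_{\mathsf{X}}(E_{\mathsf{X}})\}$. $C^*(\mathsf{X})$ is the universal $C^*$-algebra generated by a family $\{S_a:a\in\mathcal{A}\}$ of partial isometries such that there exists a $*$-homomorphism $\iota_{\mathsf{X}}:\widetilde{\mathcal{D}}_{\mathsf{X}}\to C^*(\mathsf{X})$ with $\iota_{\mathsf{X}}(\chi_{C(u,v)})=S_vS_u^*S_uS_v^*$ for all $u,v\in\mathcal{L}^\#_{\mathsf{X}}(E_{\mathsf{X}})$, where $S_u=S_{u_1}\cdots S_{u_n}$ for $u=u_1\cdots u_n$ and $S_\epsilon$ is the identity of $C^*(\mathsf{X})$. *)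

(* Defs.v *)
From HB Require Import structures.
From mathcomp Require Import all_boot all_order all_algebra.
From mathcomp Require Import complex.
From mathcomp Require Import all_classical all_reals all_analysis.

Set Implicit Arguments.
Unset Strict Implicit.
Unset Printing Implicit Defensive.

Import Order.TTheory GRing.Theory Num.Theory numFieldNormedType.Exports.

Local Open Scope classical_set_scope.
Local Open Scope ring_scope.
Local Open Scope complex_scope.

Reserved Notation "x ** y" (at level 40, left associativity).

(* A C*-algebra need not have a unit, and may be zero. The norm of a
   [normedModType R[i]] takes its values in (the nonnegative real elements of)
   [R[i]]. *)
HB.mixin Record isCStarAlgebra (R : realType) A of CompleteNormedModule R[i] A := {
  cmul : A -> A -> A;
  star : A -> A;
  cmulA : associative cmul;
  cmulDl : left_distributive cmul +%R;
  cmulDr : right_distributive cmul +%R;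
  cmulZl : forall (c : R[i]) (x y : A), cmul (c *: x) y = c *: cmul x y;
  cmulZr : forall (c : R[i]) (x y : A), cmul x (c *: y) = c *: cmul x y;
  starK : involutive star;
  starD : {morph star : x y / x + y};
  starZ : forall (c : R[i]) (x : A), star (c *: x) = c^* *: star x;
  starM : forall x y : A, star (cmul x y) = cmul (star y) (star x);
  cnormM : forall x y : A, `|cmul x y| <= `|x| * `|y|;
  cnorm_star : forall x : A, `|cmul (star x) x| = `|x| ^+ 2
}.

#[short(type="cstarType")]
HB.structure Definition CStarAlgebra (R : realType) :=
  {A of CompleteNormedModule R[i] A & isCStarAlgebra R A}.

Notation "x ** y" := (cmul x y) : ring_scope.

Section CStar.
Context {R : realType}.
Implicit Types A B : cstarType R.

Definition is_unit A (e : A) : Prop := forall x : A, e ** x = x /\ x ** e = x.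

Definition is_projection A (p : A) : Prop := p ** p = p /\ star p = p.

Definition is_partial_isometry A (s : A) : Prop := s ** star s ** s = s.

Definition star_hom A B (phi : A -> B) : Prop :=
  [/\ linear phi, {morph phi : x y / x ** y} & {morph phi : x / star x}].

Definition star_isomorphism A B (phi : A -> B) : Prop :=
  star_hom phi /\ bijective phi.

Definition cstar_subalgebra A (F : set A) : Prop :=
  [/\ closed F,
      F 0,
      forall (c : R[i]) (x y : A), F x -> F y -> F (c *: x + y),
      forall x y : A, F x -> F y -> F (x ** y) &
      forall x : A, F x -> F (star x)].

Definition cstar_generates A (G : set A) : Prop :=
  smallest (@cstar_subalgebra A) G = [set: A].

(* [A] is the universal C*-algebra generated by the family of the [g i] for
   [i] in [J], subject to the relations [rel]. The values of a family outside
   [J] are irrelevant. *)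
Definition universal_cstar (I : Type) (J : set I)
    (rel : forall B, (I -> B) -> Prop) A (g : I -> A) : Prop :=
  [/\ rel A g,
      cstar_generates (g @` J) &
      forall B (h : I -> B), rel B h ->
        exists! phi : A -> B, star_hom phi /\ {in J, forall i, phi (g i) = h i}].

End CStar.

Record labelled_graph (L : Type) := LabelledGraph {
  vertex : Type;
  edge : Type;
  src : edge -> vertex;
  rng : edge -> vertex;
  lab : edge -> L
}.

Section LabelledGraph.
Context {L : choiceType} (E : labelled_graph L).
Implicit Types (U V : set (vertex E)) (a : L) (w : seq L).

Definition lang_plus : set (seq L) :=
  [set w | exists e q, path (fun e1 e2 : edge E => `[< rng e1 = src e2 >]) e q
                       /\ w = map (@lab _ E) (e :: q)].

Definition lang_sharp : set (seq L) := lang_plus `|` [set [::]].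

Definition rel_range U a : set (vertex E) :=
  [set v | exists e : edge E, [/\ lab e = a, U (src e) & rng e = v]].

Definition out_labels U : set L :=
  [set a | exists2 e : edge E, U (src e) & lab e = a].

Definition is_sink (v : vertex E) : Prop := forall e : edge E, src e <> v.

Record labelled_space_relations (R : realType) (Bf : set (set (vertex E)))
    (A : cstarType R) (p : set (vertex E) -> A) (s : L -> A) : Prop := {
  ls_proj : forall U, Bf U -> is_projection (p U);
  ls_pisom : forall a, is_partial_isometry (s a);
  ls_set0 : p set0 = 0;
  ls_setI : forall U V, Bf U -> Bf V -> p U ** p V = p (U `&` V);
  ls_setU : forall U V, Bf U -> Bf V -> p (U `|` V) = p U + p V - p (U `&` V);
  ls_range : forall U a, Bf U -> p U ** s a = s a ** p (rel_range U a);
  ls_star_mul : forall a, star (s a) ** s a = p (rel_range setT a);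
  ls_orth : forall a b, a <> b -> star (s a) ** s b = 0;
  ls_sum : forall U, Bf U -> finite_set (out_labels U) ->
    (forall V, Bf V -> (forall v, V v -> is_sink v) -> U `&` V = set0) ->
    p U = \sum_(a \in out_labels U) (s a ** p (rel_range U a) ** star (s a))
}.

Definition is_labelled_space_cstar (R : realType) (Bf : set (set (vertex E)))
    (A : cstarType R) (p : set (vertex E) -> A) (s : L -> A) : Prop :=
  @universal_cstar R (set (vertex E) + L)%type
    [set i | if i is inl U then Bf U else True]
    (fun B h => labelled_space_relations Bf (h \o inl) (h \o inr))
    A (fun i => match i with inl U => p U | inr a => s a end).

End LabelledGraph.

Section Shift.
Context {L : finType}.
Implicit Types (X : set (nat -> L)) (u v w : seq L) (x : nat -> L).

Definition shift x : nat -> L := fun n => x n.+1.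

Definition wcat u x : nat -> L := fun n => nth (x (n - size u)%N) u n.

Definition shift_space X : Prop :=
  closed (X : set (prod_topology (fun _ : nat => discrete_topology L)))
  /\ shift @` X `<=` X.

Definition all_letters_occur X : Prop :=
  forall a : L, exists2 x, X x & exists n, x n = a.

Definition shift_graph X : labelled_graph L :=
  let E1 := [set e : X * L * X | set_val e.1.1 = wcat [:: e.1.2] (set_val e.2)]
  in @LabelledGraph L X E1 (fun e => (set_val e).1.1) (fun e => (set_val e).2)
                    (fun e => (set_val e).1.2).

Definition cyl X u v : set X :=
  [set y | exists2 x, set_val y = wcat v x & X (wcat u x)].

Definition cyls X : set (set X) :=
  [set U | exists u v, [/\ lang_sharp (shift_graph X) u,
                           lang_sharp (shift_graph X) v & U = cyl u v]].

Definition shift_sets X : set (set X) :=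
  smallest [set G | [/\ setI_closed G, setU_closed G & setD_closed G]] (@cyls X).

End Shift.

Arguments cyl {L} X u v.
Arguments cyls {L} X.
Arguments shift_sets {L} X.

Section ShiftAlgebra.
Context (R : realType) {L : finType} (X : set (nat -> L)).

Definition fun_subalgebra (F : set (X -> R[i])) : Prop :=
  [/\ F (fun=> 0),
      forall (c : R[i]) (f g : X -> R[i]), F f -> F g -> F (fun x => c * f x + g x),
      forall f g, F f -> F g -> F (fun x => f x * g x),
      forall f, F f -> F (fun x => (f x)^*%R) &
      forall f : X -> R[i], (forall e : R, 0 < e ->
                   exists2 g, F g & forall x, `|f x - g x| <= e%:C) -> F f].

(* All functions in [shift_fun_algebra] are bounded: the bounded functions form
   a uniformly closed *-subalgebra containing the indicators. *)
Definition shift_fun_algebra : set (X -> R[i]) :=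
  smallest fun_subalgebra [set \1_U | U in cyls X].

(* *-homomorphisms defined on [shift_fun_algebra]; the values of [iota] on
   other functions are irrelevant. *)
Definition shift_fun_star_hom (A : cstarType R) (iota : (X -> R[i]) -> A) : Prop :=
  let D := shift_fun_algebra in
  [/\ forall (c : R[i]) (f g : X -> R[i]), D f -> D g ->
        iota (fun x => c * f x + g x) = c *: iota f + iota g,
      forall f g, D f -> D g -> iota (fun x => f x * g x) = iota f ** iota g &
      forall f, D f -> iota (fun x => (f x)^*%R) = star (iota f)].

Definition word_mul (A : cstarType R) (e : A) (S : L -> A) (u : seq L) : A :=
  foldr (fun a x => S a ** x) e u.

(* The empty word is sent to the unit, so these relations only make sense in a
   unital C*-algebra. The unit is [iota] of the constant function 1, which is
   the sum of the [S a ** star (S a)]; it lies in the C*-algebra generated by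
   [S]. *)
Definition shift_relations (A : cstarType R) (S : L -> A) : Prop :=
  (forall a, is_partial_isometry (S a)) /\
  exists2 e : A, is_unit e &
    let Sw := word_mul e S in
    exists2 iota : (X -> R[i]) -> A, shift_fun_star_hom iota &
      forall u v, lang_sharp (shift_graph X) u -> lang_sharp (shift_graph X) v ->
        iota \1_(cyl X u v) = Sw v ** star (Sw u) ** Sw u ** star (Sw v).

Definition is_shift_cstar (A : cstarType R) (S : L -> A) : Prop :=
  @universal_cstar R L [set: L] shift_relations A S.

End ShiftAlgebra.

(* Main.v *)
Require Import Defs.
From HB Require Import structures.
From mathcomp Require Import all_boot all_order all_algebra.
From mathcomp Require Import complex.
From mathcomp Require Import all_classical all_reals all_analysis ring lra.

Set Implicit Arguments.
Unset Strict Implicit.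
Unset Printing Implicit Defensive.

Import Order.TTheory GRing.Theory Num.Theory numFieldNormedType.Exports.

Local Open Scope classical_set_scope.
Local Open Scope ring_scope.
Local Open Scope complex_scope.

(** Each of the two algebras carries a family satisfying the relations of the
    other; the universal properties then give homomorphisms in both directions,
    and uniqueness makes them mutually inverse.

    From the labelled space to the shift: the relations force p(X) to be a unit
    and, by induction on the two words, p(C(u,v)) to be the product of s_v,
    the adjoint of s_u, s_u and the adjoint of s_v ([labelled_space_cyl]). The
    point that needs analysis is the homomorphism on the algebra of functions.
    The map from U to p(U) is a finitely additive and multiplicative family of
    projections, so it extends linearly to simple functions. By the C*-identity
    the extension is contractive ([spectral_sum_norm]), and by completeness it
    extends to all uniform limits of simple functions ([calculus_complete]).
    This is [projection_valued_star_hom].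

    From the shift to the labelled space: q(U), the image under iota of the
    indicator of U, is again such a family ([star_hom_projection_valued]). The
    relation q(U) S_a = S_a q(r(U,a)) is stable under Boolean operations on U, so
    it suffices to check it on the sets C(u,v) ([iota_mul_letter]); the summation
    relation then follows from finite additivity, because the sets of points
    beginning with the letter a partition X.

    The two homomorphisms exchange S_a and s_a. The composite fixing the s_a also
    fixes the p(U): the units correspond, because p(X) is the sum of the range
    projections of the s_a, hence the formula for p(C(u,v)) is respected, and the
    sets C(u,v) generate ([projection_valued_eq]). *)

(** * Calculations in C*-algebras *)

Section CStarBasics.
Context {R : realType}.
Implicit Types A B : cstarType R.

Lemma cmul0l A (x : A) : 0 ** x = 0.
Proof. by rewrite -(scale0r x) cmulZl !scale0r. Qed.

Lemma cmul0r A (x : A) : x ** 0 = 0.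
Proof. by rewrite -(scale0r x) cmulZr !scale0r. Qed.

Lemma cmulNl A (x y : A) : (- x) ** y = - (x ** y).
Proof. by rewrite -scaleN1r cmulZl scaleN1r. Qed.

Lemma cmulNr A (x y : A) : x ** (- y) = - (x ** y).
Proof. by rewrite -scaleN1r cmulZr scaleN1r. Qed.

Lemma cmulBl A (x y z : A) : (x - y) ** z = x ** z - y ** z.
Proof. by rewrite cmulDl cmulNl. Qed.

Lemma cmulBr A (x y z : A) : z ** (x - y) = z ** x - z ** y.
Proof. by rewrite cmulDr cmulNr. Qed.

Lemma cmul_suml A (I : finType) (F : I -> A) x :
  (\sum_i F i) ** x = \sum_i F i ** x.
Proof. by apply: (big_morph (fun y => y ** x)) => [y z|]; rewrite ?cmulDl ?cmul0l. Qed.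

Lemma cmul_sumr A (I : finType) (F : I -> A) x :
  x ** (\sum_i F i) = \sum_i x ** F i.
Proof. by apply: (big_morph (fun y => x ** y)) => [y z|]; rewrite ?cmulDr ?cmul0r. Qed.

Lemma star0 A : star (0 : A) = 0.
Proof. by apply: (addrI (star (0 : A))); rewrite -starD !addr0. Qed.

Lemma star_sum A (I : finType) (F : I -> A) : star (\sum_i F i) = \sum_i star (F i).
Proof. by apply: big_morph => [y z|]; rewrite ?starD ?star0. Qed.

(** The C*-identity and submultiplicativity give the inequality from x to its
    adjoint after cancelling one factor; involutivity gives the converse. *)
Lemma cnorm_starE A (x : A) : `|star x| = `|x|.
Proof.
have le (y : A) : `|y| <= `|star y|.
  have [->|y0] := eqVneq y 0; first by rewrite star0.
  rewrite -(ler_pM2r (_ : 0 < `|y|)) ?normr_gt0// -expr2 -cnorm_star.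
  exact: cnormM.
by apply: le_anti; rewrite le andbT -{2}(starK x) le.
Qed.

Lemma star_unit A (e : A) : is_unit e -> star e = e.
Proof. by move=> he; rewrite -{2}(starK e) -(he (star e)).1 starM starK (he _).1. Qed.

Section StarHom.
Context {A B : cstarType R} (phi : A -> B) (hphi : star_hom phi).

Lemma star_homD x y : phi (x + y) = phi x + phi y.
Proof. by have [lin _ _] := hphi; rewrite -[x]scale1r lin !scale1r. Qed.

Lemma star_homN x : phi (- x) = - phi x.
Proof.
have [lin _ _] := hphi.
have h0 : phi 0 = 0 by apply: (addrI (phi 0)); rewrite -star_homD !addr0.
by rewrite -[- x]addr0 -scaleN1r lin h0 addr0 scaleN1r.
Qed.

Lemma star_homB x y : phi (x - y) = phi x - phi y.
Proof. by rewrite star_homD star_homN. Qed.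

Lemma star_hom0 : phi 0 = 0.
Proof. by rewrite -(subrr 0) star_homB subrr. Qed.

Lemma star_hom_sum (I : finType) (F : I -> A) : phi (\sum_i F i) = \sum_i phi (F i).
Proof. by apply: big_morph => [y z|]; rewrite ?star_homD ?star_hom0. Qed.

Lemma star_homM x y : phi (x ** y) = phi x ** phi y.
Proof. by have [_ + _] := hphi; apply. Qed.

Lemma star_hom_star x : phi (star x) = star (phi x).
Proof. by have [_ _] := hphi; apply. Qed.

Lemma star_hom_word (L : finType) (e : A) (S : L -> A) (u : seq L) :
  phi (word_mul e S u) = word_mul (phi e) (phi \o S) u.
Proof. by elim: u => //= a u ih; rewrite star_homM ih. Qed.

End StarHom.

Lemma star_hom_comp A B (C : cstarType R) (phi : A -> B) (psi : B -> C) :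
  star_hom phi -> star_hom psi -> star_hom (psi \o phi).
Proof.
move=> [l1 m1 s1] [l2 m2 s2]; split=> [c x y|x y|x] /=.
- by rewrite l1 l2.
- by rewrite m1 m2.
- by rewrite s1 s2.
Qed.

(** A bounded linear map is continuous, and points are closed. *)
Lemma closed_ker A (f : A -> A) (M : R[i]) : linear f ->
  (forall x, `|f x| <= M * `|x|) -> closed [set x | f x = 0].
Proof.
move=> lin bnd.
pose g : {linear A -> A} := HB.pack f (GRing.isLinear.Build _ _ _ _ f lin).
have cg : continuous g.
  apply/linear_bounded_continuous/bounded_funP => r.
  exists (`|M| * r) => x xr; apply: (le_trans (bnd x)).
  have Mr : M * `|x| \is Num.real.
    by apply: ger0_real; apply: le_trans (bnd x).
  apply: (le_trans (real_ler_norm Mr)).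
  by rewrite normrM normr_id ler_wpM2l.
have : closed [set (0 : A)].
  exact: accessible_closed_set1 (hausdorff_accessible (@norm_hausdorff _ A)) _.
by move=> /(preimage_closed (f := g)); apply => x _; exact: cg.
Qed.

(** The elements on which a projection acts as the identity from both sides form
    a closed star-subalgebra, so it is enough to look at generators. *)
Lemma unit_of_generators A (G : set A) (e : A) : cstar_generates G -> is_projection e ->
  (forall x, G x -> e ** x = x /\ x ** e = x) -> is_unit e.
Proof.
move=> gen [ee es] eG.
suff : smallest (@cstar_subalgebra R A) G `<=` [set x | e ** x = x /\ x ** e = x].
  by rewrite gen => eT x; exact: eT.
apply: smallest_sub => //; split => /=.
- rewrite (_ : mkset _ = [set x | e ** x - x = 0] `&` [set x | x ** e - x = 0]).
    apply: closedI; apply: (@closed_ker _ _ (`|e| + 1)).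
    + by move=> c x y; rewrite cmulDr cmulZr scalerBr opprD addrACA.
    + by move=> x; rewrite (le_trans (ler_normB _ _))// mulrDl mul1r lerD// cnormM.
    + by move=> c x y; rewrite cmulDl cmulZl scalerBr opprD addrACA.
    + move=> x; rewrite (le_trans (ler_normB _ _))// mulrDl mul1r lerD//.
      by rewrite mulrC cnormM.
  apply/seteqP; split => x /= [ex xe].
    by rewrite ex xe subrr.
  by split; apply/eqP; rewrite -subr_eq0 ?ex ?xe.
- by rewrite cmul0l cmul0r.
- move=> c x y [ex xe] [ey ye].
  by rewrite cmulDr cmulDl cmulZr cmulZl ex xe ey ye.
- by move=> x y [ex xe] [ey ye]; rewrite cmulA ex -cmulA ye.
- by move=> x [ex xe]; split; rewrite -{1}es -starM ?xe ?ex.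
Qed.

End CStarBasics.

(** * Projection-valued set functions and simple functions *)

(** If t were larger than r, the powers of t / r would be unbounded by
    Bernoulli's inequality. Only the exponents 2 ^ k are assumed, since these are
    the ones that iterating the C*-identity produces. *)
Lemma le_of_expn_le_cst (R : realType) (t r C : R) : 0 <= t -> 0 <= r ->
  (forall k, t ^+ (2 ^ k) <= r ^+ (2 ^ k) * C) -> t <= r.
Proof.
move=> t0 r0 H; rewrite leNgt; apply/negP => rt.
have t_gt0 : 0 < t by exact: le_lt_trans rt.
have r_gt0 : 0 < r.
  rewrite lt_def r0 andbT; apply/eqP => rE.
  by have := H 0%N; rewrite expn0 !expr1 rE mul0r leNgt t_gt0.
pose q := t / r - 1.
have q0 : 0 < q by rewrite subr_gt0 ltr_pdivlMr// mul1r.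
have tr : t / r = 1 + q by rewrite addrC subrK.
clearbody q; have bern n : 1 + n%:R * q <= (t / r) ^+ n.
  elim: n => [|n ih]; first by rewrite mul0r addr0 expr0.
  rewrite exprS; apply: le_trans (ler_wpM2l _ ih); last by rewrite tr addr_ge0 ?(ltW q0).
  rewrite tr mulrDl mul1r mulrDr mulr1 -natr1 mulrDl mul1r addrA lerD2l lerDl.
  by apply: mulr_ge0 (ltW q0) (mulr_ge0 _ (ltW q0)).
have [k Ck] : exists k : nat, C < k%:R * q.
  exists (Num.truncn (C / q)).+1; rewrite -ltr_pdivrMr//; exact: truncnS_gt.
have := H k; rewrite -ler_pdivrMl ?exprn_gt0// mulrC -expr_div_n => tC.
have := le_trans (bern _) tC; rewrite leNgt => /negP; apply.
apply: (lt_trans Ck); rewrite ltr_wpDl// ltr_pM2r// ltr_nat ltn_expl//.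
Qed.

Record projection_valued (R : realType) (T : Type) (Bf : set (set T))
    (A : cstarType R) (p : set T -> A) : Prop := {
  pv_field : [/\ Bf setT, setI_closed Bf, setU_closed Bf & setD_closed Bf];
  pv_proj : forall U, Bf U -> is_projection (p U);
  pv_set0 : p set0 = 0;
  pv_setI : forall U V, Bf U -> Bf V -> p U ** p V = p (U `&` V);
  pv_setU : forall U V, Bf U -> Bf V -> p (U `|` V) = p U + p V - p (U `&` V)
}.

Section SpectralSums.
Context {R : realType} {T : Type} (Bf : set (set T)) {A : cstarType R} (p : set T -> A).
Context (hp : projection_valued Bf p).

Definition measurable_levels (J : Type) (m : T -> J) := forall j, Bf (m @^-1` [set j]).

Lemma pv_set0_mem : Bf set0.
Proof.
by have [[BT BI BU BD] _ _ _ _] := hp; rewrite -(setDv setT); apply: BD.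
Qed.

Lemma pv_setD U V : Bf U -> Bf V -> p (U `\` V) = p U - p (U `&` V).
Proof.
move=> BU BV; have [[_ BI _ BD] _ p0 _ pU] := hp.
have := pU _ _ (BD _ _ BU BV) (BI _ _ BU BV).
rewrite setUC setUIDK => ->.
rewrite (_ : (U `\` V) `&` _ = set0) ?p0 ?subr0 ?addrK//.
by apply/seteqP; split=> x // [[_ nV] [_ /nV]].
Qed.

(** Finite additivity over the level sets of a map to a finite type, by induction
    on the list of values already collected. *)
Lemma pv_sum_levels (J : finType) (m : T -> J) U : measurable_levels m -> Bf U ->
  p U = \sum_j p (U `&` m @^-1` [set j]).
Proof.
move=> hm BU.
have [[_ BI BsU BD] _ p0 pI pU] := hp.
have H (s : seq J) : uniq s -> Bf (U `&` m @^-1` [set` s]) /\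
    p (U `&` m @^-1` [set` s]) = \sum_(j <- s) p (U `&` m @^-1` [set j]).
  elim: s => [_|j s ih /= /andP[js us]].
    rewrite big_nil (_ : _ `&` _ = set0); last by apply/seteqP; split => x [] // _.
    by split=> //; exact: pv_set0_mem.
  have [Bs ps] := ih us; have Bj : Bf (U `&` m @^-1` [set j]) by apply: BI.
  have -> : U `&` m @^-1` [set` j :: s] =
      (U `&` m @^-1` [set j]) `|` (U `&` m @^-1` [set` s]).
    apply/seteqP; split => [x [Ux] /=|x [[Ux /= ->]|[Ux /= xs]]] /=.
    - by rewrite inE => /orP[/eqP xj|xs]; [left|right].
    - by rewrite inE eqxx.
    - by split=> //; rewrite inE xs orbT.
  split; first exact: BsU.
  rewrite pU// ps big_cons (_ : (_ `&` _) `&` (_ `&` _) = set0) ?p0 ?subr0//.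
  apply/seteqP; split => x // [[_ /= mxj] [_ /=]].
  by rewrite mxj (negPf js).
have [_ <-] := H (index_enum J) (index_enum_uniq J).
by congr p; apply/seteqP; split => x => [Ux|[]] //; split => //=; rewrite mem_index_enum.
Qed.

(** The integral of the simple function [h \o m] against [p]. A simple function
    is represented by a labelling [m] of the space by a finite type together with
    values [h] of the labels: two such functions are brought to a common labelling
    by pairing, which avoids refining partitions. *)
Definition spectral_sum (J : finType) (m : T -> J) (h : J -> R[i]) : A :=
  \sum_j h j *: p (m @^-1` [set j]).

(** The integral does not depend on the labelling, because a coarser level set is
    the disjoint union of the finer ones it contains. *)
Lemma spectral_sum_comp (J K : finType) (n : T -> K) (phi : K -> J) (h : J -> R[i]) :
  measurable_levels n -> measurable_levels (phi \o n) ->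
  spectral_sum n (h \o phi) = spectral_sum (phi \o n) h.
Proof.
move=> hn hm; rewrite /spectral_sum.
transitivity (\sum_j \sum_k h j *: p ((phi \o n) @^-1` [set j] `&` n @^-1` [set k])).
  rewrite exchange_big; apply: eq_bigr => k _ /=.
  rewrite (bigD1 (phi k))//= big1 ?addr0 => [|j jk].
    by congr (_ *: p _); apply/seteqP; split => x /= => [->|[]].
  rewrite (_ : _ `&` _ = set0) ?(pv_set0 hp) ?scaler0//.
  by apply/seteqP; split => x //= [pj nk]; move: jk; rewrite -pj nk eqxx.
by apply: eq_bigr => j _; rewrite -scaler_sumr -pv_sum_levels.
Qed.

Lemma measurable_levels_pair (J K : Type) (m : T -> J) (n : T -> K) :
  measurable_levels m -> measurable_levels n -> measurable_levels (fun x => (m x, n x)).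
Proof.
move=> hm hn [j k]; have [[_ BI _ _] _ _ _ _] := hp.
rewrite (_ : _ @^-1` _ = m @^-1` [set j] `&` n @^-1` [set k]); first exact: BI.
by apply/seteqP; split => x /= => [[]|[-> ->]].
Qed.

Lemma spectral_sum_lin (J : finType) (m : T -> J) c h k :
  c *: spectral_sum m h + spectral_sum m k = spectral_sum m (fun j => c * h j + k j).
Proof.
rewrite /spectral_sum scaler_sumr -big_split; apply: eq_bigr => j _ /=.
by rewrite scalerDl scalerA.
Qed.

Lemma spectral_sum_mul (J : finType) (m : T -> J) h k : measurable_levels m ->
  spectral_sum m h ** spectral_sum m k = spectral_sum m (fun j => h j * k j).
Proof.
move=> hm; rewrite /spectral_sum cmul_suml; apply: eq_bigr => j _.
rewrite cmul_sumr (bigD1 j)//= big1 ?addr0 => [|i ij].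
  by rewrite cmulZl cmulZr scalerA (pv_proj hp (hm j)).1.
rewrite cmulZl cmulZr (pv_setI hp)// (_ : _ `&` _ = set0) ?(pv_set0 hp) ?scaler0//.
by apply/seteqP; split => x //= [mj mi]; move: ij; rewrite -mj -mi eqxx.
Qed.

Lemma spectral_sum_star (J : finType) (m : T -> J) h : measurable_levels m ->
  star (spectral_sum m h) = spectral_sum m (fun j => (h j)^*).
Proof.
move=> hm; rewrite /spectral_sum star_sum; apply: eq_bigr => j _.
by rewrite starZ (pv_proj hp (hm j)).2.
Qed.

(** Contractivity without spectral theory. The triangle inequality bounds the
    norm by a constant C times r, with C depending on [m] only. The square of the
    norm of the sum of [h] is the norm of the sum of the squared modulus of [h],
    so the same C serves after squaring r any number of times, and it becomes
    harmless on taking roots. *)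
Lemma spectral_sum_norm (J : finType) (m : T -> J) h (r : R[i]) : measurable_levels m ->
  0 <= r -> (forall x, `|h (m x)| <= r) -> `|spectral_sum m h| <= r.
Proof.
move=> hm r0 hr.
pose C := \sum_j `|p (m @^-1` [set j])|.
have pow k : forall h r, 0 <= r -> (forall x, `|h (m x)| <= r) ->
    `|spectral_sum m h| ^+ (2 ^ k) <= r ^+ (2 ^ k) * C.
  elim: k => [|k ih] {hr r0} {}h {}r r0 hr.
    rewrite expn0 !expr1 mulr_sumr (le_trans (ler_norm_sum _ _ _))//.
    apply: ler_sum => j _; rewrite normrZ.
    have [[x mx]|nx] := pselect (exists x, m x = j).
      by rewrite ler_wpM2r// -mx.
    rewrite (_ : _ @^-1` _ = set0) ?(pv_set0 hp) ?normr0 ?mulr0//.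
    by apply/seteqP; split => x //= mx; case: nx; exists x.
  rewrite expnS !exprM -cnorm_star spectral_sum_star// spectral_sum_mul//.
  apply: ih => [|x]; first exact: exprn_ge0.
  by rewrite normrM norm_conjC expr2 ler_pM.
have C0 : 0 <= C by apply: sumr_ge0.
have /complex_realP[c Cc] := ger0_real C0.
have /complex_realP[a ra] := ger0_real r0.
have /complex_realP[t st] := ger0_real (normr_ge0 (spectral_sum m h)).
have t0 : 0 <= t by rewrite -ler0c -st.
rewrite st ra lecR.
apply: (@le_of_expn_le_cst _ _ _ c) => // [|k]; first by rewrite -ler0c -ra.
by rewrite -lecR rmorphM !rmorphXn/= -st -ra -Cc; exact: pow.
Qed.

End SpectralSums.

(** * Extension to uniform limits of simple functions *)

Lemma norm_eps0 (R : realType) (V : normedModType R[i]) (x : V) :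
  (forall e : R, 0 < e -> `|x| <= e%:C) -> x = 0.
Proof.
move=> H; apply/eqP; rewrite -normr_le0.
have /complex_realP[t xt] := ger0_real (normr_ge0 x).
rewrite xt -[0]/(0%:C) lecR; apply/ler_addgt0Pr => e e0.
by rewrite add0r -lecR -xt; exact: H.
Qed.

Lemma real_norm (R : realType) (V : normedZmodType R[i]) (x : V) :
  exists2 t : R, 0 <= t & `|x| = t%:C.
Proof.
have /complex_realP[t xt] := ger0_real (normr_ge0 x).
by exists t => //; rewrite -ler0c -xt.
Qed.

Section FunctionalCalculus.
Context {R : realType} {T : Type} (Bf : set (set T)) {A : cstarType R} (p : set T -> A).
Context (hp : projection_valued Bf p).

Definition simple_pair (f : T -> R[i]) (b : A) := exists (J : finType) (m : T -> J) h,
  [/\ measurable_levels Bf m, f = h \o m & b = spectral_sum p m h].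

Lemma simple_pair_common f g b c : simple_pair f b -> simple_pair g c ->
  exists (J : finType) (m : T -> J) h k, [/\ measurable_levels Bf m,
    f = h \o m, b = spectral_sum p m h, g = k \o m & c = spectral_sum p m k].
Proof.
move=> [J [m [h [hm -> ->]]]] [K [n [k [hn -> ->]]]].
have hmn := measurable_levels_pair hp hm hn.
exists (J * K)%type, (fun x => (m x, n x)), (h \o fst), (k \o snd).
split=> //.
- exact: esym (spectral_sum_comp hp (phi := fst) h hmn hm).
- exact: esym (spectral_sum_comp hp (phi := snd) k hmn hn).
Qed.

Lemma simple_pair_lin c f g b b' : simple_pair f b -> simple_pair g b' ->
  simple_pair (fun x => c * f x + g x) (c *: b + b').
Proof.
move=> fb gb; have [J [m [h [k [hm -> -> -> ->]]]]] := simple_pair_common fb gb.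
by exists J, m, (fun j => c * h j + k j); split; rewrite ?spectral_sum_lin.
Qed.

Lemma simple_pair_mul f g b b' : simple_pair f b -> simple_pair g b' ->
  simple_pair (fun x => f x * g x) (b ** b').
Proof.
move=> fb gb; have [J [m [h [k [hm -> -> -> ->]]]]] := simple_pair_common fb gb.
by exists J, m, (fun j => h j * k j); split; rewrite ?(spectral_sum_mul hp).
Qed.

Lemma simple_pair_star f b : simple_pair f b ->
  simple_pair (fun x => (f x)^*) (star b).
Proof.
move=> [J [m [h [hm -> ->]]]].
by exists J, m, (fun j => (h j)^*); split; rewrite ?(spectral_sum_star hp).
Qed.

Lemma simple_pair_norm f b (r : R[i]) : simple_pair f b -> 0 <= r ->
  (forall x, `|f x| <= r) -> `|b| <= r.
Proof. by move=> [J [m [h [hm -> ->]]]] r0; exact: (spectral_sum_norm hp). Qed.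

Lemma simple_pair_dist f g b c (r : R[i]) : simple_pair f b -> simple_pair g c -> 0 <= r ->
  (forall x, `|f x - g x| <= r) -> `|b - c| <= r.
Proof.
move=> fb gc r0 fgr.
rewrite addrC -scaleN1r.
apply: (simple_pair_norm (simple_pair_lin (-1) gc fb)) => // x.
by rewrite mulN1r addrC.
Qed.

Lemma simple_pair_indic U : Bf U -> simple_pair \1_U (p U).
Proof.
move=> BU; have [[BT _ _ BD] _ _ _ _] := hp.
have UT : (fun x => x \in U) @^-1` [set true] = U.
  by apply/seteqP; split=> x; [exact: set_mem|exact: mem_set].
exists bool, (fun x => x \in U), (fun b : bool => b%:R); split => //.
  case; rewrite ?UT//.
  rewrite (_ : _ @^-1` _ = [set: T] `\` U); first exact: BD.
  apply/seteqP; split=> x /=.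
    by move=> xU; split=> // /mem_set; rewrite xU.
  by move=> [_ xU]; exact: memNset.
by rewrite /spectral_sum big_bool /= UT scale1r scale0r addr0.
Qed.

Lemma simple_pair_bounded f b : simple_pair f b ->
  exists2 M : R, 0 <= M & forall x, `|f x| <= M%:C.
Proof.
move=> [J [m [h [_ -> _]]]].
have S0 : 0 <= \sum_j `|h j| by apply: sumr_ge0.
have /complex_realP[M SM] := ger0_real S0.
exists M; first by rewrite -ler0c -SM.
by move=> x /=; rewrite -SM (bigD1 (m x))//= lerDl sumr_ge0.
Qed.

(** The closure of the graph of the integral on simple functions, as a relation
    between functions and elements of the algebra. Working with the graph lets the
    algebraic operations be treated before any limit is known to exist. *)
Definition calculus (f : T -> R[i]) (b : A) := forall e : R, 0 < e -> exists g c,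
  [/\ simple_pair g c, forall x, `|f x - g x| <= e%:C & `|b - c| <= e%:C].

Lemma calculus_simple f b : simple_pair f b -> calculus f b.
Proof.
move=> fb e e0; exists f, b; split=> // [x|]; rewrite subrr normr0 ler0c ltW//.
Qed.

(** Nearby simple functions have nearby integrals, by contractivity. *)
Lemma calculus_unique f b b' : calculus f b -> calculus f b' -> b = b'.
Proof.
move=> fb fb'; apply/eqP; rewrite -subr_eq0; apply/eqP/norm_eps0 => e e0.
have e4 : 0 < e / 4 by rewrite divr_gt0.
have [g [c [gc fg bc]]] := fb _ e4; have [g' [c' [gc' fg' bc']]] := fb' _ e4.
have cc' : `|c - c'| <= (e / 4)%:C + (e / 4)%:C.
  apply: (simple_pair_dist gc gc') => [|x].
    by rewrite -rmorphD ler0c addr_ge0// ltW.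
  rewrite -(subrKA (f x)) (le_trans (ler_normD _ _))// lerD//.
  by rewrite distrC.
have -> : e = e / 4 + ((e / 4 + e / 4) + e / 4) by lra.
rewrite rmorphD !rmorphD -(subrKA c) (le_trans (ler_normD _ _))// lerD//.
rewrite -(subrKA c') (le_trans (ler_normD _ _))// lerD//.
by rewrite distrC.
Qed.

Lemma calculus_lin (k : R[i]) f g b c : calculus f b -> calculus g c ->
  calculus (fun x => k * f x + g x) (k *: b + c).
Proof.
move=> fb gc e e0.
have [K K0 kK] := real_norm k.
(* Dividing by K + 1 instead of K covers the case k = 0. *)
pose d := e / 2 / (K + 1).
have d0 : 0 < d by rewrite !divr_gt0// ltr_wpDl.
have e2 : 0 < e / 2 by rewrite divr_gt0.
have Kd : K * d <= e / 2.
  rewrite /d mulrA ler_pdivrMr ?ltr_wpDl// mulrC ler_wpM2l ?lerDl// ltW//.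
have [f' [b' [fb' ff bb]]] := fb _ d0; have [g' [c' [gc' gg cc]]] := gc _ e2.
exists (fun x => k * f' x + g' x), (k *: b' + c').
have small (x y : R[i]) : x <= d%:C -> y <= (e / 2)%:C -> `|k| * x + y <= e%:C.
  move=> xd ye; have -> : e = e / 2 + e / 2 by lra.
  rewrite rmorphD lerD// kK (@le_trans _ _ (K%:C * d%:C))// ?ler_wpM2l ?ler0c//.
  by rewrite -rmorphM lecR.
split=> [|x|]; first exact: simple_pair_lin.
- rewrite opprD addrACA -mulrBr (le_trans (ler_normD _ _))// normrM.
  exact: small (ff x) (gg x).
- rewrite opprD addrACA -scalerBr (le_trans (ler_normD _ _))// normrZ.
  exact: small.
Qed.

Lemma calculus_star f b : calculus f b -> calculus (fun x => (f x)^*) (star b).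
Proof.
move=> fb e e0; have [g [c [gc fg bc]]] := fb _ e0.
exists (fun x => (g x)^*), (star c); split=> [|x|].
- exact: simple_pair_star.
- by rewrite -rmorphB norm_conjC.
- have starN : star (- c) = - star c.
    by apply/eqP; rewrite -addr_eq0 -starD addNr star0.
  by rewrite -starN -starD cnorm_starE.
Qed.

Lemma calculus_bounded f b : calculus f b ->
  exists2 M : R, 0 <= M & (forall x, `|f x| <= M%:C) /\ `|b| <= M%:C.
Proof.
move=> fb; have [g [c [gc fg bc]]] := fb 1 ltr01.
have [M M0 gM] := simple_pair_bounded gc.
have cM : `|c| <= M%:C by apply: simple_pair_norm gc _ gM; rewrite ler0c.
exists (M + 1); first by rewrite addr_ge0.
rewrite rmorphD addrC; split=> [x|].
  by rewrite -(subrK (g x) (f x)) (le_trans (ler_normD _ _))// lerD.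
by rewrite -(subrK c b) (le_trans (ler_normD _ _))// lerD.
Qed.

Lemma calculus_mul f g b c : calculus f b -> calculus g c ->
  calculus (fun x => f x * g x) (b ** c).
Proof.
move=> fb gc e e0.
have [M M0 [fM bM]] := calculus_bounded fb.
have [N N0 [gN cN]] := calculus_bounded gc.
pose K := M + (1 + N).
have K0 : 0 < K by rewrite ltr_wpDl// ltr_pwDl.
(* With d at most 1, the approximation of the second factor is bounded by N + 1,
   so the total error is at most M d + d (1 + N). *)
pose d := Num.min 1 (e / K).
have d0 : 0 < d by rewrite lt_min ltr01 divr_gt0.
have d1 : d <= 1 by rewrite ge_min lexx.
have dK : d * K <= e by rewrite -ler_pdivlMr// ge_min lexx orbT.
have [f' [b' [fb' ff bb]]] := fb _ d0; have [g' [c' [gc' gg cc]]] := gc _ d0.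
exists (fun x => f' x * g' x), (b' ** c').
have small (x y z w v : R[i]) : 0 <= x -> 0 <= y -> 0 <= z -> 0 <= w -> 0 <= v ->
    x <= M%:C -> y <= d%:C -> z <= d%:C -> w <= d%:C -> v <= N%:C ->
    x * y + z * (w + v) <= e%:C.
  move=> x0 y0 z0 w0 v0 xM yd zd wd vN.
  apply: (@le_trans _ _ (M%:C * d%:C + d%:C * (1 + N%:C))).
    rewrite lerD ?ler_pM ?addr_ge0// lerD// (le_trans wd)//.
    by rewrite -[1]/(1%:C) lecR.
  by rewrite mulrC -mulrDr -[1]/(1%:C) -!rmorphD -rmorphM lecR.
split=> [|x|]; first exact: simple_pair_mul.
- have -> : f x * g x - f' x * g' x = f x * (g x - g' x) + (f x - f' x) * g' x.
    by rewrite mulrBr mulrBl addrA subrK.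
  rewrite (le_trans (ler_normD _ _))// !normrM.
  apply: le_trans (small _ _ _ _ _ _ _ _ _ _ (fM x) (gg x) (ff x) (gg x) (gN x)) => //.
  rewrite lerD// ler_wpM2l// -{1}[g' x](subKr (g x)) [leRHS]addrC.
  by rewrite ler_normB.
- have -> : b ** c - b' ** c' = b ** (c - c') + (b - b') ** c'.
    by rewrite cmulBr cmulBl addrA subrK.
  rewrite (le_trans (ler_normD _ _))//.
  apply: le_trans (small _ _ _ _ _ _ _ _ _ _ bM cc bb cc cN) => //.
  rewrite lerD ?cnormM//; apply: (le_trans (cnormM _ _)).
  rewrite ler_wpM2l// -{1}[c'](subKr c) [leRHS]addrC.
  by rewrite ler_normB.
Qed.

(** Simple approximations at distance 1 / (n + 1) from [f] have integrals forming
    a Cauchy sequence. *)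
Lemma calculus_complete f :
  (forall e : R, 0 < e -> exists g c, simple_pair g c /\ forall x, `|f x - g x| <= e%:C) ->
  exists b, calculus f b.
Proof.
move=> H.
have inv0 n : 0 < n.+1%:R^-1 :> R by rewrite invr_gt0.
have /choice[u hu] n : exists gc : (T -> R[i]) * A, simple_pair gc.1 gc.2 /\
    forall x, `|f x - gc.1 x| <= (n.+1%:R^-1 : R)%:C.
  by have [g [c gc]] := H _ (inv0 n); exists (g, c).
have du n k : `|(u n).2 - (u k).2| <= (n.+1%:R^-1 + k.+1%:R^-1 : R)%:C.
  have [un fn] := hu n; have [uk fk] := hu k.
  apply: (simple_pair_dist un uk) => [|x]; first by rewrite ler0c addr_ge0// ltW.
  rewrite -(subrKA (f x)) (le_trans (ler_normD _ _))// rmorphD lerD//.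
  by rewrite distrC.
have : cauchy ((fun n => (u n).2) @ \oo).
  apply: cauchy_exP => e e0.
  have /complex_realP[r er] := ger0_real (ltW e0).
  have r2 : 0 < r / 2 by rewrite divr_gt0// -ltcR -er.
  have near2 : \forall n \near \oo, n.+1%:R^-1 < r / 2.
    exact: (near_infty_natSinv_lt (PosNum r2)).
  have [k _ /= kr] := near2.
  exists (u k).2; near=> n; rewrite -ball_normE /= (le_lt_trans (du _ _))//.
  rewrite er ltcR (splitr r) ltrD//; first by apply: kr => /=.
  by near: n.
move=> /cauchy_cvgP /cvg_ex[b ub]; exists b => e e0.
have : \forall n \near \oo, n.+1%:R^-1 <= e /\ `|b - (u n).2| <= e%:C.
  near=> n; split; first by apply: ltW; near: n; exact: (near_infty_natSinv_lt (PosNum e0)).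
  by near: n; move/cvgrPdist_le : ub; apply; rewrite ltcR.
move=> [n _ /(_ n (leqnn n))[ne nb]].
have [un fn] := hu n.
exists (u n).1, (u n).2; split=> // x.
by rewrite (le_trans (fn x))// lecR.
Unshelve. all: by end_near. Qed.

Lemma calculus_closed f :
  (forall e : R, 0 < e -> exists2 g, (exists b, calculus g b) &
     forall x, `|f x - g x| <= e%:C) -> exists b, calculus f b.
Proof.
move=> H; apply: calculus_complete => e e0.
have e2 : 0 < e / 2 by rewrite divr_gt0.
have [g [b gb] fg] := H _ e2; have [g' [c [gc gg _]]] := gb _ e2.
exists g', c; split=> // x.
by rewrite -(subrKA (g x)) (le_trans (ler_normD _ _))// (splitr e) rmorphD lerD.
Qed.

End FunctionalCalculus.

(** * Points, words and relative ranges in a shift space *)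

Section Words.
Context {L : finType}.
Implicit Types (u v w : seq L) (x y : nat -> L) (a b : L).

Lemma wcat_nil x : wcat [::] x = x.
Proof. by apply/funext => n; rewrite /wcat subn0 nth_nil. Qed.

Lemma wcat_cat u v x : wcat (u ++ v) x = wcat u (wcat v x).
Proof.
apply/funext => n; rewrite /wcat nth_cat size_cat subnDA.
have [nu|un] := ltnP n (size u); first exact: set_nth_default.
by rewrite [RHS]nth_default.
Qed.

Lemma wcat_cons a u x : wcat (a :: u) x = wcat [:: a] (wcat u x).
Proof. by rewrite -wcat_cat. Qed.

Lemma wcat_rcons u a x : wcat (rcons u a) x = wcat u (wcat [:: a] x).
Proof. by rewrite -cats1 wcat_cat. Qed.

Lemma shift_wcat1 a x : Defs.shift (wcat [:: a] x) = x.
Proof. by apply/funext => n; rewrite /Defs.shift /wcat /= nth_nil subn1. Qed.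

Lemma wcat1_shift x : wcat [:: x 0%N] (Defs.shift x) = x.
Proof. by apply/funext => -[//|n]; rewrite /Defs.shift /wcat /= nth_nil subn1. Qed.

Lemma wcat1_inj a b x y : wcat [:: a] x = wcat [:: b] y -> a = b /\ x = y.
Proof.
move=> e; split; first by have := congr1 (fun z => z 0%N) e.
by rewrite -(shift_wcat1 a x) e shift_wcat1.
Qed.

End Words.

Section ShiftSets.
Context {L : finType} {X : set (nat -> L)}.
Context (hX : shift_space X).
Implicit Types (u v w : seq L) (x y : X) (a b : L) (U V : set X).

Local Notation E := (shift_graph X).
Local Notation r := (@rel_range L (shift_graph X)).

Lemma shift_space_wcat u (x : nat -> L) : X (wcat u x) -> X x.
Proof.
elim: u => [|a u ih]; first by rewrite wcat_nil.
rewrite wcat_cons => Xx; apply: ih.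
by rewrite -(shift_wcat1 a (wcat u x)); apply: hX.2; exists (wcat [:: a] (wcat u x)).
Qed.

Definition shift_point (z : nat -> L) (Xz : X z) : X := exist _ z (mem_set Xz).

Lemma set_val_inj x y : set_val x = set_val y -> x = y.
Proof. exact: val_inj. Qed.

Lemma edge_ex a x y : set_val x = wcat [:: a] (set_val y) ->
  exists e : edge E, [/\ src e = x, rng e = y & lab e = a].
Proof. by move=> xy; unshelve eexists (exist _ (x, a, y) _); first exact: mem_set. Qed.

Lemma edge_src (e : edge E) : set_val (src e) = wcat [:: lab e] (set_val (rng e)).
Proof. by case: e => -[[x a] y] /= /set_mem. Qed.

Lemma rel_rangeP U a y :
  r U a y <-> exists2 x, U x & set_val x = wcat [:: a] (set_val y).
Proof.
split=> [[e [<- Ue <-]]|[x Ux xy]]; first by exists (src e) => //; exact: edge_src.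
by have [e [es er ea]] := edge_ex xy; exists e; rewrite es.
Qed.

(** A point beginning with [u] is the source of a path labelled [u], through the
    successive shifts of the point. The source is kept in the induction so that
    the next edge can be attached to it. *)
Lemma lang_sharp_wcat u (x : nat -> L) : X (wcat u x) -> lang_sharp E u.
Proof.
case: u => [|a u] Xux; first by right.
left; suff [e [q [? ? _]]] : exists e q, [/\
    path (fun e1 e2 : edge E => `[< rng e1 = src e2 >]) e q,
    a :: u = map (@lab _ E) (e :: q) & set_val (src e) = wcat (a :: u) x].
  by exists e, q.
elim: u a Xux => [|b u ih] a Xux.
  have Xx : X x by exact: shift_space_wcat Xux.
  have [e [es er ea]] := @edge_ex a (shift_point Xux) (shift_point Xx) erefl.
  by exists e, [::]; split=> //; [rewrite -ea|rewrite es].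
have Xbux : X (wcat (b :: u) x).
  by apply: (@shift_space_wcat [:: a]); rewrite -wcat_cons.
have [e' [q [pq bq se']]] := ih b Xbux.
have [|e [es er ea]] := @edge_ex a (shift_point Xux) (src e').
  by rewrite se' /= -wcat_cons.
exists e, (e' :: q); split.
- by rewrite /= pq andbT; apply/asboolP.
- by rewrite bq -ea.
- by rewrite es.
Qed.

Lemma lang_sharp_behead a u : lang_sharp E (a :: u) -> lang_sharp E u.
Proof.
move=> [[e [[|e' q] [/= pq [_ ->]]]]|//]; first by right.
by left; exists e', q; move: pq => /andP[].
Qed.

(** A vertex has only one predecessor along a given letter, so relative ranges are
    preimages under a partial map and commute with the Boolean operations. *)
Lemma rel_rangeI U V a : r (U `&` V) a = r U a `&` r V a.
Proof.
apply/seteqP; split=> y.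
  by move=> /rel_rangeP[x [Ux Vx] xy]; split; apply/rel_rangeP; exists x.
move=> [/rel_rangeP[x Ux xy] /rel_rangeP[x' Vx' xy']]; apply/rel_rangeP.
by exists x => //; split=> //; rewrite (@set_val_inj x x') // xy.
Qed.

Lemma rel_rangeU U V a : r (U `|` V) a = r U a `|` r V a.
Proof.
apply/seteqP; split=> y.
  by move=> /rel_rangeP[x [Ux|Vx] xy]; [left|right]; apply/rel_rangeP; exists x.
by move=> [] /rel_rangeP[x Ux xy]; apply/rel_rangeP; exists x => //; [left|right].
Qed.

Lemma rel_rangeD U V a : r (U `\` V) a = r U a `\` r V a.
Proof.
apply/seteqP; split=> y.
  move=> /rel_rangeP[x [Ux nVx] xy]; split; first by apply/rel_rangeP; exists x.
  move=> /rel_rangeP[x' Vx' xy']; apply: nVx.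
  by rewrite (@set_val_inj x x') // xy.
move=> [/rel_rangeP[x Ux xy] nV]; apply/rel_rangeP; exists x => //; split=> // Vx.
by apply: nV; apply/rel_rangeP; exists x.
Qed.

Lemma rel_rangeT a : r setT a = cyl X [:: a] [::].
Proof.
apply/seteqP; split=> y.
  move=> /rel_rangeP[x _ xy]; exists (set_val y); first by rewrite wcat_nil.
  by rewrite -xy; exact: set_valP.
move=> [z yz Xz]; apply/rel_rangeP; exists (shift_point Xz) => //=.
by rewrite yz wcat_nil.
Qed.

Lemma rel_range_cyl_nil u a : r (cyl X u [::]) a = cyl X (rcons u a) [::].
Proof.
apply/seteqP; split=> y.
  move=> /rel_rangeP[x [z xz Xuz] xy]; exists (set_val y); first by rewrite wcat_nil.
  by move: Xuz; rewrite wcat_rcons -xy xz wcat_nil.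
move=> [z yz]; rewrite wcat_rcons => Xz; apply/rel_rangeP.
exists (shift_point (shift_space_wcat Xz)); last by rewrite yz wcat_nil.
by exists (wcat [:: a] z); rewrite ?wcat_nil.
Qed.

Lemma rel_range_cyl_cons u a v :
  r (cyl X u (a :: v)) a = cyl X u v `&` cyl X [:: a] [::].
Proof.
apply/seteqP; split=> y.
  move=> /rel_rangeP[x [z xz Xuz] xy]; split.
    exists z => //; move: xz; rewrite xy (wcat_cons a v) => /wcat1_inj[] //.
  exists (set_val y); first by rewrite wcat_nil.
  by rewrite -xy; exact: set_valP.
move=> [[z yz Xuz] [z' yz' Xaz]]; apply/rel_rangeP.
exists (shift_point Xaz); last by rewrite yz' wcat_nil.
by exists z; rewrite //= (wcat_cons a v) -yz yz' wcat_nil.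
Qed.

Lemma rel_range_cyl_neq u a b v : a <> b -> r (cyl X u (b :: v)) a = set0.
Proof.
move=> ab; apply/seteqP; split=> y // /rel_rangeP[x [z xz _] xy].
by move: xz; rewrite xy (wcat_cons b v) => /wcat1_inj[/ab].
Qed.

Lemma cyl_nil : cyl X [::] [::] = setT.
Proof.
apply/seteqP; split=> x // _; exists (set_val x); rewrite wcat_nil//.
exact: set_valP.
Qed.

Lemma shift_sets_field : [/\ shift_sets X setT, setI_closed (shift_sets X),
  setU_closed (shift_sets X) & setD_closed (shift_sets X)].
Proof.
split.
- apply: sub_gen_smallest; exists [::], [::].
  by rewrite cyl_nil; split => //; right.
- by move=> U V BU BV G hG; have [[GI _ _] _] := hG; exact: GI (BU _ hG) (BV _ hG).
- by move=> U V BU BV G hG; have [[_ GU _] _] := hG; exact: GU (BU _ hG) (BV _ hG).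
- by move=> U V BU BV G hG; have [[_ _ GD] _] := hG; exact: GD (BU _ hG) (BV _ hG).
Qed.

Lemma shift_sets_set0 : shift_sets X set0.
Proof. by have [BT _ _ BD] := shift_sets_field; rewrite -(setDv setT); apply: BD. Qed.

(** If [u] or [v] is not in the language then the set is empty. *)
Lemma shift_sets_cyl u v : shift_sets X (cyl X u v).
Proof.
have [[x [z xz Xuz]]|ne] := pselect (cyl X u v !=set0); last first.
  rewrite (_ : cyl X u v = set0); first exact: shift_sets_set0.
  by apply/seteqP; split=> x // ux; case: ne; exists x.
apply: sub_gen_smallest; exists u, v; split=> //; first exact: lang_sharp_wcat Xuz.
by apply: (@lang_sharp_wcat _ z); rewrite -xz; exact: set_valP.
Qed.

Lemma shift_sets_ind (P : set (set X)) : setI_closed P -> setU_closed P -> setD_closed P ->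
  (forall u v, lang_sharp E u -> lang_sharp E v -> P (cyl X u v)) ->
  forall U, shift_sets X U -> P U.
Proof.
move=> PI PU PD Pc U; apply: smallest_sub; first by [].
by move=> _ [u [v [Lu Lv ->]]]; exact: Pc.
Qed.

(** By compatibility with the Boolean operations, the range formulas for the sets
    C(u,v) suffice. *)
Lemma shift_sets_rel_range U a : shift_sets X U -> shift_sets X (r U a).
Proof.
have [BT BI BU BD] := shift_sets_field.
move: U; apply: shift_sets_ind.
- by move=> U V HU HV; rewrite /= rel_rangeI; exact: BI.
- by move=> U V HU HV; rewrite /= rel_rangeU; exact: BU.
- by move=> U V HU HV; rewrite /= rel_rangeD; exact: BD.
- move=> u [|b v] _ _ /=; first by rewrite rel_range_cyl_nil; exact: shift_sets_cyl.
  have [->|/eqP ab] := eqVneq a b.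
    by rewrite rel_range_cyl_cons; apply: BI; exact: shift_sets_cyl.
  by rewrite rel_range_cyl_neq//; exact: shift_sets_set0.
Qed.

Lemma rel_range_out U a : ~ out_labels (E := E) U a -> r U a = set0.
Proof.
move=> nUa; apply/seteqP; split=> y // [e [ea Ue _]]; apply: nUa.
by exists e.
Qed.

End ShiftSets.

(** * Passing between the two families of relations *)

Section Indicators.
Context {R : realType} {T : Type}.
Implicit Types U V : set T.

Lemma indicI_fun U V : \1_(U `&` V) = (fun x => \1_U x * \1_V x) :> (T -> R[i]).
Proof. exact: indicI. Qed.

Lemma indicU_fun U V : \1_(U `|` V) =
  (fun x => 1 * \1_U x + (-1 * \1_(U `&` V) x + \1_V x)) :> (T -> R[i]).
Proof.
apply/funext => x; rewrite !indicE in_setU in_setI.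
by case: (x \in U); case: (x \in V) => /=; ring.
Qed.

Lemma indicD_fun U V : \1_(U `\` V) =
  (fun x => -1 * \1_(U `&` V) x + \1_U x) :> (T -> R[i]).
Proof.
apply/funext => x; rewrite !indicE in_setD in_setI.
by case: (x \in U); case: (x \in V) => /=; ring.
Qed.

Lemma indic_conj U : (fun x => (\1_U x)^*%R) = \1_U :> (T -> R[i]).
Proof. by apply/funext => x; rewrite indicE; exact: conjC_nat. Qed.

End Indicators.

Lemma word_mul_rcons (R : realType) (L : finType) (A : cstarType R) (e : A) (S : L -> A) u a :
  is_unit e -> word_mul e S (rcons u a) = word_mul e S u ** S a.
Proof.
move=> he; elim: u => [|b u ih] /=; first by rewrite (he _).1 (he _).2.
by rewrite ih cmulA.
Qed.

Section Shift.
Context {R : realType} {L : finType} {X : set (nat -> L)}.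
Context (hX : shift_space X).

Local Notation E := (shift_graph X).
Local Notation r := (@rel_range L (shift_graph X)).

Lemma shift_fun_algebra_indic U : shift_sets X U -> @shift_fun_algebra R L X \1_U.
Proof.
move=> BU F [[F0 Flin Fmul Fstar Fcl] FG].
have FI V W : F \1_V -> F \1_W -> F \1_(V `&` W).
  by move=> FV FW; rewrite indicI_fun; exact: Fmul.
move: U BU; apply: (@shift_sets_ind _ _ [set U | F \1_U]) => /=.
- exact: FI.
- move=> V W /= FV FW; rewrite indicU_fun.
  by apply: (Flin) => //; apply: (Flin) => //; exact: FI.
- move=> V W /= FV FW; rewrite indicD_fun.
  by apply: Flin => //; exact: FI.
- by move=> u v Lu Lv; apply: FG; exists (cyl X u v) => //; exists u, v.
Qed.

Section Iota.
Context {A : cstarType R}.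

(** The functions that have an integral form a uniformly closed star-algebra
    containing the generating indicators, hence contain the whole function
    algebra. *)
Lemma projection_valued_star_hom (p : set X -> A) :
  projection_valued (shift_sets X) p ->
  exists2 iota, @shift_fun_star_hom R L X A iota &
    forall U, shift_sets X U -> iota \1_U = p U.
Proof.
move=> hp.
pose iota f := xget 0 [set b | calculus (shift_sets X) p f b].
have iotaE f b : calculus (shift_sets X) p f b -> iota f = b.
  by move=> fb; apply: (calculus_unique hp (xgetI 0 fb) fb).
have dom f : @shift_fun_algebra R L X f -> calculus (shift_sets X) p f (iota f).
  move=> Df; suff [b fb] : exists b, calculus (shift_sets X) p f b.
    by rewrite (iotaE _ _ fb).
  move: f Df; apply: smallest_sub.
    split.
    - exists (p set0); rewrite (_ : (fun=> 0) = \1_set0); last by rewrite indic0.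
      apply: calculus_simple; apply: (simple_pair_indic hp).
      exact: pv_set0_mem hp.
    - move=> c f g [b fb] [b' gb']; exists (c *: b + b').
      exact: calculus_lin.
    - by move=> f g [b fb] [b' gb']; exists (b ** b'); exact: calculus_mul.
    - by move=> f [b fb]; exists (star b); exact: calculus_star.
    - exact: calculus_closed.
  move=> _ [U [u [v [_ _ ->]]] <-]; exists (p (cyl X u v)).
  apply: calculus_simple; apply: (simple_pair_indic hp); exact: shift_sets_cyl.
exists iota.
  split=> [c f g Df Dg|f g Df Dg|f Df]; apply: iotaE.
  - exact: calculus_lin (dom _ Df) (dom _ Dg).
  - exact: calculus_mul (dom _ Df) (dom _ Dg).
  - exact: calculus_star (dom _ Df).
by move=> U BU; apply/iotaE/calculus_simple/(simple_pair_indic hp).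
Qed.

(** Indicators turn Boolean operations on sets into algebraic operations on
    functions, which a homomorphism respects. *)
Lemma star_hom_projection_valued (iota : (X -> R[i]) -> A) : @shift_fun_star_hom R L X A iota ->
  projection_valued (shift_sets X) (fun U => iota \1_U).
Proof.
move=> [lin mul st].
have D := shift_fun_algebra_indic.
have [BT BI BU BD] := @shift_sets_field L X.
have pI U V : shift_sets X U -> shift_sets X V ->
    iota \1_U ** iota \1_V = iota \1_(U `&` V).
  by move=> hU hV; rewrite -mul ?indicI_fun//; exact: D.
have D0 := D _ (@shift_sets_set0 L X).
split=> //.
- move=> U hU; split; first by rewrite pI// setIid.
  by rewrite -st ?indic_conj//; exact: D.
- suff -> : iota \1_set0 = -1 *: iota \1_set0 + iota \1_set0.
    by rewrite scaleN1r addNr.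
  rewrite -lin//; congr iota.
  by apply/funext => x; rewrite indic0 mulr0 addr0.
- move=> U V hU hV; rewrite indicU_fun.
  have DUV : @shift_fun_algebra R L X (fun x => -1 * \1_(U `&` V) x + \1_V x).
    rewrite (_ : (fun x => _) = \1_(V `\` U)); first by apply: D; exact: BD.
    by rewrite indicD_fun setIC.
  rewrite lin ?lin//; try by apply: D => //; exact: BI.
  by rewrite scale1r scaleN1r [- _ + _]addrC addrA.
Qed.

End Iota.

(** Letters that label no edge out of [U] have empty relative range. *)
Lemma sum_out_labels (A : cstarType R) (p : set X -> A) (s : L -> A) U : p set0 = 0 ->
  \sum_(a \in out_labels (E := E) U) (s a ** p (r U a) ** star (s a)) =
  \sum_a s a ** p (r U a) ** star (s a).
Proof.
move=> p0; apply: fsbig_fwiden => [a _ /=||a [_ /rel_range_out ra]].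
- by rewrite mem_index_enum.
- exact: index_enum_uniq.
- by rewrite /preimage /mkset ra p0 cmul0r cmul0l.
Qed.

(** The sets on which the two sides agree are stable under the Boolean
    operations, so agreement on the sets C(u,v) is enough. *)
Lemma projection_valued_eq (A B : cstarType R) (phi : A -> B) (q : set X -> A) (p : set X -> B) :
  star_hom phi -> projection_valued (shift_sets X) q -> projection_valued (shift_sets X) p ->
  (forall u v, phi (q (cyl X u v)) = p (cyl X u v)) ->
  forall U, shift_sets X U -> phi (q U) = p U.
Proof.
move=> hphi hq hp cylE.
have [BT BI BU BD] := @shift_sets_field L X.
have qpI V W : shift_sets X V -> shift_sets X W -> phi (q V) = p V ->
    phi (q W) = p W -> phi (q (V `&` W)) = p (V `&` W).
  move=> BV BW eV eW.
  by rewrite -(pv_setI hq)// -(pv_setI hp)// (star_homM hphi) eV eW.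
suff H U : shift_sets X U -> shift_sets X U /\ phi (q U) = p U by move=> U /H[].
move: U; apply: (@shift_sets_ind _ _ [set U | _]) => /=.
- by move=> V W [BV eV] [BW eW]; split; [exact: BI|exact: qpI].
- move=> V W [BV eV] [BW eW]; split; first exact: BU.
  rewrite (pv_setU hq)// (pv_setU hp)//.
  by rewrite (star_homB hphi) (star_homD hphi) eV eW qpI.
- move=> V W [BV eV] [BW eW]; split; first exact: BD.
  by rewrite (pv_setD hq)// (pv_setD hp)// (star_homB hphi) eV qpI.
- by move=> u v _ _; split; [exact: shift_sets_cyl|exact: cylE].
Qed.

Section Labelled.
Context {A : cstarType R} (p : set X -> A) (s : L -> A).
Context (hr : @labelled_space_relations L E R (shift_sets X) A p s).

Lemma labelled_space_projection_valued : projection_valued (shift_sets X) p.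
Proof. by case: hr => *; split=> //; exact: shift_sets_field. Qed.

(** The whole space absorbs every set of the field, and p(X) s_a = s_a because
    p(X) s_a is s_a times its source projection. *)
Lemma labelled_space_unit (G : set A) : cstar_generates G ->
  G `<=` [set p U | U in shift_sets X] `|` range s -> is_unit (p setT).
Proof.
move=> gen Gps; have [BT _ _ _] := @shift_sets_field L X.
apply: (unit_of_generators gen); first exact: (ls_proj hr).
move=> x /Gps[[U BU <-]|[a _ <-]].
  by rewrite !(ls_setI hr)// setTI setIT.
have sa := ls_pisom hr a; split.
  by rewrite (ls_range hr)// -(ls_star_mul hr) cmulA.
rewrite -{1}sa -cmulA -cmulA [star _ ** _]cmulA (ls_star_mul hr) (ls_setI hr)//; last first.
  exact: shift_sets_rel_range.
by rewrite setIT -(ls_star_mul hr) cmulA.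
Qed.

(** The alphabet is finite and every vertex emits an edge, so the summation
    relation applies to every set of the field. *)
Lemma labelled_space_sum U : shift_sets X U ->
  p U = \sum_a s a ** p (r U a) ** star (s a).
Proof.
move=> BU; rewrite (ls_sum hr)//.
- exact/sum_out_labels/(ls_set0 hr).
- exact: finite_finset.
- move=> V _ sink; apply/seteqP; split=> x // [_ /sink].
  have Xs : X (Defs.shift (set_val x)).
    by apply: hX.2; exists (set_val x) => //; exact: set_valP.
  have [e [es _ _]] := @edge_ex _ X (set_val x 0%N) x (shift_point Xs) (esym (wcat1_shift _)).
  by move=> /(_ e).
Qed.

Lemma labelled_space_range_conj U a : shift_sets X U ->
  p (r U a) = star (s a) ** p U ** s a.
Proof.
move=> BU; rewrite -cmulA (ls_range hr)// cmulA (ls_star_mul hr) (ls_setI hr).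
- congr p; apply/seteqP; split=> x; last by case.
  by move=> rx; split=> //; case: rx => e [? ? ?]; exists e.
- by apply: shift_sets_rel_range => //; have [] := @shift_sets_field L X.
- exact: shift_sets_rel_range.
Qed.

(** Appending a letter to [u] takes a relative range, which conjugates by the
    adjoint of the generator. Prepending a letter b to [v] leaves b as the only
    letter out of the set, so the summation relation has a single term. *)
Lemma labelled_space_cyl u v : is_unit (p setT) ->
  let w := word_mul (p setT) s in
  p (cyl X u v) = w v ** star (w u) ** w u ** star (w v).
Proof.
move=> he w.
suff pu : p (cyl X u [::]) = star (w u) ** w u.
  elim: v => [|b v ih].
    by rewrite pu /w /= (star_unit he) (he _).1 (he _).2.
  rewrite labelled_space_sum; last exact: shift_sets_cyl.
  rewrite (bigD1 b)//= big1 ?addr0 => [|a ab]; last first.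
    rewrite rel_range_cyl_neq; last exact/eqP.
    by rewrite (ls_set0 hr) cmul0r cmul0l.
  rewrite rel_range_cyl_cons -(ls_setI hr); try exact: shift_sets_cyl.
  have key : star (s b) ** (s b ** star (s b)) = star (s b).
    by rewrite -[in RHS](ls_pisom hr b) !starM starK.
  by rewrite -rel_rangeT -(ls_star_mul hr) ih /w /= starM -!cmulA key.
elim/last_ind: u => [|u a ih]; first by rewrite cyl_nil /w /= (star_unit he) (he _).1.
rewrite -rel_range_cyl_nil// labelled_space_range_conj; last exact: shift_sets_cyl.
by rewrite ih /w word_mul_rcons// starM !cmulA.
Qed.

Lemma labelled_space_shift_relations : is_unit (p setT) -> @shift_relations R L X A s.
Proof.
move=> he; split; first exact: (ls_pisom hr).
exists (p setT) => //=.
have [iota hi iotaE] := projection_valued_star_hom labelled_space_projection_valued.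
exists iota => // u v _ _.
by rewrite iotaE ?labelled_space_cyl//; exact: shift_sets_cyl.
Qed.

End Labelled.

Lemma lang_sharp_letter a : all_letters_occur X -> lang_sharp E [:: a].
Proof.
move=> /(_ a)[x Xx [n <-]].
have [Xn <-] : X (iter n Defs.shift x) /\ iter n Defs.shift x 0%N = x n.
  elim: n x Xx => // n ih x Xx; rewrite iterSr.
  by apply: ih; apply: hX.2; exists x.
by apply: (@lang_sharp_wcat _ _ hX _ (Defs.shift (iter n Defs.shift x))); rewrite wcat1_shift.
Qed.

Lemma cyl_nil_letter a : cyl X [::] [:: a] = (fun x : X => set_val x 0%N) @^-1` [set a].
Proof.
apply/seteqP; split=> x /=; first by move=> [z -> _].
move=> xa; exists (Defs.shift (set_val x)); first by rewrite -xa wcat1_shift.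
by rewrite wcat_nil; apply: hX.2; exists (set_val x) => //; exact: set_valP.
Qed.

Section ShiftToLabelled.
Context {A : cstarType R} (S : L -> A) (e : A) (iota : (X -> R[i]) -> A).
Context (hL : all_letters_occur X).
Context (hS : forall a, is_partial_isometry (S a)).
Context (he : is_unit e).
Context (hi : @shift_fun_star_hom R L X A iota).
Local Notation w := (word_mul e S).
Context (hcyl : forall u v, lang_sharp E u -> lang_sharp E v ->
  iota \1_(cyl X u v) = w v ** star (w u) ** w u ** star (w v)).

Local Notation q U := (iota \1_U).
Let hq := star_hom_projection_valued hi.

Lemma iota_setT : q setT = e.
Proof.
have Lnil : lang_sharp E [::] by right.
by rewrite -cyl_nil (hcyl Lnil Lnil) /= (star_unit he) !(he _).1.
Qed.

Lemma iota_cyl_right u : lang_sharp E u -> q (cyl X u [::]) = star (w u) ** w u.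
Proof.
move=> Lu; have Lnil : lang_sharp E [::] by right.
by rewrite (hcyl Lu Lnil) /= (star_unit he) (he _).1 (he _).2.
Qed.

Lemma iota_letter_source a : q (cyl X [:: a] [::]) = star (S a) ** S a.
Proof. by rewrite (iota_cyl_right (lang_sharp_letter _ hL)) /= (he _).2. Qed.

Lemma iota_letter_range a : q (cyl X [::] [:: a]) = S a ** star (S a).
Proof.
have Lnil : lang_sharp E [::] by right.
rewrite (hcyl Lnil (lang_sharp_letter a hL)) /= (star_unit he) (he (S a)).2.
by rewrite !(he _).2.
Qed.

(** The projection of C(u, empty word) commutes with the range projection of S_a,
    and multiplying by the latter fixes S_a. If the word [u] followed by [a] is
    not in the language, the hypothesis on iota says nothing about it, but the two
    projections then belong to disjoint sets and both sides vanish. *)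
Lemma iota_mul_letter_nil u a : lang_sharp E u ->
  q (cyl X u [::]) ** S a = S a ** q (cyl X (rcons u a) [::]).
Proof.
move=> Lu; have Bu : shift_sets X (cyl X u [::]) by exact: shift_sets_cyl.
have Ba : shift_sets X (cyl X [::] [:: a]) by exact: shift_sets_cyl.
have comm : q (cyl X u [::]) ** S a = q (cyl X [::] [:: a] `&` cyl X u [::]) ** S a.
  by rewrite setIC -(pv_setI hq)// iota_letter_range -!cmulA [S a ** (_ ** _)]cmulA hS.
have [Lua|nLua] := pselect (lang_sharp E (rcons u a)).
  rewrite comm -(pv_setI hq)// iota_letter_range iota_cyl_right// iota_cyl_right//.
  by rewrite word_mul_rcons// starM !cmulA.
have ne (z : nat -> L) : ~ X (wcat (rcons u a) z).
  by move=> /(lang_sharp_wcat hX).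
rewrite comm (_ : _ `&` _ = set0).
  rewrite (_ : cyl X (rcons u a) [::] = set0) ?(pv_set0 hq) ?cmul0l ?cmul0r//.
  by apply/seteqP; split=> x // [z _ /ne].
apply/seteqP; split=> x // [[z xz _] [z' xz' Xuz']].
by apply: (ne z); rewrite wcat_rcons -xz xz' wcat_nil.
Qed.

(** The ranges are the projections of the disjoint sets of points beginning
    with a and with b. *)
Lemma iota_orth a b : a <> b -> star (S a) ** S b = 0.
Proof.
move=> ab.
have ranges : (S a ** star (S a)) ** (S b ** star (S b)) = 0.
  rewrite -!iota_letter_range (pv_setI hq); try exact: shift_sets_cyl.
  rewrite (_ : _ `&` _ = set0) ?(pv_set0 hq)//.
  by rewrite !cyl_nil_letter; apply/seteqP; split=> x // [/= -> ].
have sS : star (S a) ** (S a ** star (S a)) = star (S a).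
  by rewrite -[in RHS](hS a) !starM starK.
transitivity (star (S a) ** ((S a ** star (S a)) ** (S b ** star (S b))) ** S b).
  by rewrite -{1}sS -{1}(hS b) !cmulA.
by rewrite ranges cmul0r cmul0l.
Qed.

Lemma iota_mul_letter U a : shift_sets X U -> q U ** S a = S a ** q (r U a).
Proof.
have [BT BI BU BD] := @shift_sets_field L X.
have Br V : shift_sets X V -> shift_sets X (r V a) by exact: shift_sets_rel_range.
have pI := pv_setI hq.
have qD V W : shift_sets X V -> shift_sets X W -> q (V `\` W) = q V - q (V `&` W).
  exact: (pv_setD hq).
have eI V W : shift_sets X V -> shift_sets X W -> q V ** S a = S a ** q (r V a) ->
    q W ** S a = S a ** q (r W a) -> q (V `&` W) ** S a = S a ** q (r (V `&` W) a).
  move=> BV BW eV eW; rewrite rel_rangeI -!pI//; try exact: Br.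
  by rewrite -cmulA eW cmulA eV cmulA.
suff H : shift_sets X U -> shift_sets X U /\ q U ** S a = S a ** q (r U a).
  by move=> /H[].
move: U; apply: (@shift_sets_ind _ _ [set U | _]) => /=.
- by move=> V W [BV eV] [BW eW]; split; [exact: BI|exact: eI].
- move=> V W [BV eV] [BW eW]; split; first exact: BU.
  rewrite rel_rangeU !(pv_setU hq)//; try exact: Br.
  by rewrite -rel_rangeI cmulBl cmulDl cmulBr cmulDr eV eW eI.
- move=> V W [BV eV] [BW eW]; split; first exact: BD.
  rewrite rel_rangeD !qD//; try exact: Br.
  by rewrite -rel_rangeI cmulBl cmulBr eV eI.
move=> u [|b v] Lu Lv; (split; first exact: shift_sets_cyl).
  by rewrite rel_range_cyl_nil//; exact: iota_mul_letter_nil.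
rewrite (hcyl Lu Lv) /= -!cmulA starM -!cmulA.
have [<-|/eqP ab] := eqVneq a b; last first.
  rewrite rel_range_cyl_neq// (pv_set0 hq) cmul0r.
  by rewrite iota_orth ?cmul0r//; exact: nesym.
rewrite rel_range_cyl_cons -pI; try exact: shift_sets_cyl.
by rewrite iota_letter_source (hcyl Lu (lang_sharp_behead Lv)) !cmulA.
Qed.

(** For the summation relation, each term is q(U) times the projection of the
    points beginning with a, and the first letter partitions the space. *)
Lemma iota_labelled_space_relations :
  @labelled_space_relations L E R (shift_sets X) A (fun U => q U) S.
Proof.
have [BT BI BU BD] := @shift_sets_field L X.
case: (hq) => _ proj p0 pI pU; split=> //.
- by move=> U a; exact: iota_mul_letter.
- by move=> a; rewrite rel_rangeT iota_letter_source.
- by move=> a b; exact: iota_orth.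
move=> U HU _ _; rewrite (sum_out_labels (p := fun V => iota \1_V))//.
have lev a : shift_sets X ((fun x : X => set_val x 0%N) @^-1` [set a]).
  by rewrite -cyl_nil_letter; exact: shift_sets_cyl.
rewrite (pv_sum_levels hq lev HU); apply: eq_bigr => a _.
rewrite -iota_mul_letter// -cmulA -iota_letter_range pI//.
  by rewrite cyl_nil_letter.
exact: shift_sets_cyl.
Qed.

End ShiftToLabelled.

End Shift.

Lemma shift_relations_labelled_space (R : realType) (L : finType) (X : set (nat -> L))
    (A : cstarType R) (S : L -> A) :
  shift_space X -> all_letters_occur X -> @shift_relations R L X A S ->
  exists2 q : set X -> A,
    @labelled_space_relations L (shift_graph X) R (shift_sets X) A q S & is_unit (q setT).
Proof.
move=> hX hL [hS [e he [iota hi hcyl]]].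
exists (fun U => iota \1_U); first exact: iota_labelled_space_relations hcyl.
by rewrite (iota_setT he hcyl).
Qed.

Theorem proposition5p6 (R : realType) (L : finType) (X : set (nat -> L))
  (hX : shift_space X) (hL : all_letters_occur X)
  (CE : cstarType R) (p : set X -> CE) (s : L -> CE)
  (hCE : @is_labelled_space_cstar L (shift_graph X) R (shift_sets X) CE p s)
  (CX : cstarType R) (S : L -> CX)
  (hCX : @is_shift_cstar R L X CX S) :
  exists phi : CX -> CE,
    star_isomorphism phi /\ forall a : L, phi (S a) = s a.
Proof.
have [relE0 genE univE] := hCE; have [relX _ univX] := hCX.
have relE : @labelled_space_relations L (shift_graph X) R (shift_sets X) CE p s := relE0.
have unitE : is_unit (p setT).
  apply: (labelled_space_unit hX relE genE) => _ [[U|a] /= BU <-].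
    by left; exists U.
  by right; exists a.
have [phi [[hphi phiS] _]] := univX CE s (labelled_space_shift_relations hX relE unitE).
have [q relQ unitQ] := shift_relations_labelled_space hX hL relX.
have [psi [[hpsi psig] _]] :=
  univE CX (fun i => match i with inl U => q U | inr a => S a end) relQ.
have {}phiS a : phi (S a) = s a by apply: phiS; exact: mem_set.
have psis a : psi (s a) = S a by apply: (psig (inr a)); exact: mem_set.
have psip U : shift_sets X U -> psi (p U) = q U.
  by move=> BU; apply: (psig (inl U)); exact: mem_set.
(* Units are not preserved automatically: both sides are expanded as sums of
   range projections of the generators. *)
have phie : phi (q setT) = p setT.
  have [BT _ _ _] := @shift_sets_field L X.
  rewrite (labelled_space_sum hX relQ BT) (labelled_space_sum hX relE BT).
  rewrite (star_hom_sum hphi); apply: eq_bigr => a _.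
  rewrite -(ls_star_mul relQ) -(ls_star_mul relE).
  by rewrite !(star_homM hphi) !(star_hom_star hphi) phiS.
have phiq U : shift_sets X U -> phi (q U) = p U.
  move: U; apply: (projection_valued_eq hX hphi).
  - exact: labelled_space_projection_valued relQ.
  - exact: labelled_space_projection_valued relE.
  move=> u v; rewrite (labelled_space_cyl hX relQ)// (labelled_space_cyl hX relE)//.
  rewrite !(star_homM hphi) !(star_hom_star hphi) !(star_hom_word hphi) phie.
  by rewrite (_ : phi \o S = s)//; apply/funext.
exists phi; split=> //; split=> //; exists psi => x.
- have [f [_ uniq]] := univX CX S relX.
  have e1 : f = psi \o phi.
    apply: uniq; split; first exact: star_hom_comp.
    by move=> a _ /=; rewrite phiS psis.
  by rewrite -[psi _]/((psi \o phi) x) -e1 (uniq id).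
- have [f [_ uniq]] := univE CE _ relE0.
  have e1 : f = phi \o psi.
    apply: uniq; split; first exact: star_hom_comp.
    move=> [U|a] /=; last by rewrite psis phiS.
    by move=> /set_mem BU; rewrite psip// phiq.
  by rewrite -[phi _]/((phi \o psi) x) -e1 (uniq id).
Qed.
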